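(* There is a universal constant $\varkappa>0$ such that the following holds. Let $\bar d\ge1$, $d=2\bar d$, let $\chi$ be a probability distribution on $[0,1]^{\bar d}$ and let $D$ be a database of $n$ i.i.d. samples from $\chi$. For $i\in\{S,C\}$ let $f^i_D$ be the \texttt{SUM} ($i=S$) or \texttt{COUNT} ($i=C$) observed query function and $f^i_\chi(\mathbf{q})=\mathbb{E}_{D\sim\chi}[f^i_D(\mathbf{q})]$ the corresponding distribution query function. Then for every $\varepsilon_2>0$ and $i\in\{S,C\}$, $$\mathbb{P}_{D\sim\chi}\Big[\tfrac1n\big\|f^i_\chi-f^i_D\big\|_\infty>\varepsilon_2\Big]\le\varkappa^{d+1}\,d\,\varepsilon_2^{-d}\exp\!\big(-\varkappa^{-1}\varepsilon_2^2 n\big).$$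
   Context: A query is $\mathbf{q}=(\mathbf{c},\mathbf{r})$ with $\mathbf{c},\mathbf{r}\in[0,1]^{\bar d}$, ranging over $\mathcal{Q}=\{(\mathbf{c},\mathbf{r})\in[0,1]^d: c_j+r_j\le1\ \forall j\}$. A point $\mathbf{p}$ matches $\mathbf{q}$ if $c_j\le p_j<c_j+r_j$ for all $j$. Fix a measure attribute index $m\in\{1,\dots,\bar d\}$. $f^C_D(\mathbf{q})$ is the number of points of $D$ matching $\mathbf{q}$, and $f^S_D(\mathbf{q})=\sum_{\mathbf{p}\in D\text{ matching }\mathbf{q}}p_m$. $\|g\|_\infty=\sup_{\mathbf{q}\in\mathcal{Q}}|g(\mathbf{q})|$. *)

(* Defs.v *)
From HB Require Import structures.
From mathcomp Require Import all_boot all_order all_algebra.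
From mathcomp Require Import all_classical all_reals all_analysis.
Set Implicit Arguments. Unset Strict Implicit. Unset Printing Implicit Defensive.
Import Order.TTheory GRing.Theory Num.Theory.
Local Open Scope classical_set_scope.
Local Open Scope ring_scope.

(* A point of [0,1]^dbar (ambient R^dbar) is a dbar-tuple of reals.
   A query q = (c, r) is a pair of dbar-tuples. *)
Definition query (R : realType) (dbar : nat) := (dbar.-tuple R * dbar.-tuple R)%type.

Definition Qspace (R : realType) (dbar : nat) : set (query R dbar) :=
  [set q | forall j : 'I_dbar,
     0 <= tnth q.1 j <= 1 /\ 0 <= tnth q.2 j <= 1 /\ tnth q.1 j + tnth q.2 j <= 1].

Definition matches (R : realType) (dbar : nat) (q : query R dbar) (p : dbar.-tuple R) : bool :=
  [forall j : 'I_dbar, (tnth q.1 j <= tnth p j) && (tnth p j < tnth q.1 j + tnth q.2 j)].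

Inductive aggr := SUM | COUNT.

Definition fD (R : realType) (dbar n : nat) (m : 'I_dbar) (i : aggr)
  (D : 'I_n -> dbar.-tuple R) (q : query R dbar) : R :=
  match i with
  | COUNT => \sum_(k < n) (matches q (D k))%:R
  | SUM => \sum_(k < n) (matches q (D k))%:R * tnth (D k) m
  end.

Definition supnorm (R : realType) (dbar : nat) (g : query R dbar -> R) : \bar R :=
  ereal_sup [set (`|g q|)%:E | q in (@Qspace R dbar)].

Definition mutually_independent (R : realType) (d : measure_display) (Omega : measurableType d)
  (d' : measure_display) (T : measurableType d') (n : nat)
  (P : probability Omega R) (X : 'I_n -> Omega -> T) : Prop :=
  forall A : 'I_n -> set T, (forall k, measurable (A k)) ->
    P (\bigcap_(k in [set: 'I_n]) (X k @^-1` A k)) = (\prod_(k < n) P (X k @^-1` A k))%E.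

Definition has_law (R : realType) (d : measure_display) (Omega : measurableType d)
  (d' : measure_display) (T : measurableType d')
  (P : probability Omega R) (X : Omega -> T) (chi : probability T R) : Prop :=
  forall A : set T, measurable A -> P (X @^-1` A) = chi A.

(* Main.v *)
(** Ghost-sample (Vapnik-Chervonenkis) argument.  A box meets a finite set of
    points in the trace of the bounding box of at most [2 * dbar] of them, so on
    [2 n] points there are at most [u^(- 2 dbar) (1 + u)^(2 n)] traces, for every
    [u] in ]0, 1].  Jensen, symmetrization and Chernoff bound the COUNT tail by
    [2 u^(- 2 dbar) (1 + u)^(2 n) exp (- 2 c eps^2 n)]; choosing [u] a small
    multiple of [eps^2] costs only a fraction of the exponent and leaves
    [(C / eps^2)^(2 dbar) exp (- c eps^2 n)].  Since a probability [p <= 1]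
    satisfies [p^2 <= p], taking the square root halves the power of [1 / eps].
    SUM deviations are averages of COUNT deviations over the levels of [p_m]. *)

Require Import Defs.
From HB Require Import structures.
From mathcomp Require Import all_boot all_order all_algebra.
From mathcomp Require Import all_classical all_reals all_analysis.
From mathcomp Require Import measurable_realfun ring lra zify.
Set Implicit Arguments.
Unset Strict Implicit.
Unset Printing Implicit Defensive.
Import Order.TTheory GRing.Theory Num.Theory numFieldNormedType.Exports.
Local Open Scope classical_set_scope.
Local Open Scope ring_scope.

(** * Counting the traces of boxes on a finite set of points *)

(* The trace of a box on a finite set of points is recovered from the points
   extremal in each coordinate, as the trace of their bounding box. *)
Lemma matches_hull (R : realType) (dbar : nat) (K : finType)
    (y : K -> dbar.-tuple R) (q : query R dbar) : (0 < dbar)%N ->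
  exists2 E : {set K}, (#|E| <= 2 * dbar)%N &
    forall k, matches q (y k) =
      [forall j, [exists e in E, tnth (y e) j <= tnth (y k) j]
              && [exists e in E, tnth (y k) j <= tnth (y e) j]].
Proof.
move=> dbar_gt0; case: (pickP (fun k => matches q (y k))) => [k0 qk0|q0]; last first.
  (* If no point is matched, the empty set works: its hull test already fails at one coordinate, and
     there is one since [0 < dbar]. *)
  exists finset.set0 => [|k]; first by rewrite cards0.
  rewrite q0; apply/esym/negbTE/forallPn; exists (Ordinal dbar_gt0).
  by rewrite negb_and; apply/orP; left; apply/existsPn => e; rewrite inE.
pose lo j := [arg min_(k < k0 | matches q (y k)) tnth (y k) j]%O.
pose hi j := [arg max_(k > k0 | matches q (y k)) tnth (y k) j]%O.
exists ([set lo j | j in 'I_dbar] :|: [set hi j | j in 'I_dbar])%SET => [|k].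
  rewrite (leq_trans (leq_card_setU _ _))// mul2n -addnn.
  by apply: leq_add; rewrite (leq_trans (leq_imset_card _ _))// card_ord.
apply/idP/forallP => [qk j|Hk].
  apply/andP; split; apply/existsP.
    exists (lo j); rewrite inE imset_f//= /lo; case: arg_minP => // i _; exact.
  exists (hi j); rewrite inE imset_f ?orbT//= /hi; case: arg_maxP => // i _; exact.
have qE e : (e \in [set lo j | j in 'I_dbar] :|: [set hi j | j in 'I_dbar])%SET ->
    matches q (y e).
  rewrite inE => /orP[] /imsetP[j _ ->].
    by rewrite /lo; case: arg_minP.
  by rewrite /hi; case: arg_maxP.
apply/forallP => j; have /andP[/existsP[e /andP[/qE qe le_e]]] := Hk j.
move=> /existsP[f /andP[/qE qf le_f]].
have /andP[+ _] := forallP qe j; have /andP[_ +] := forallP qf j.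
by move=> /(le_lt_trans le_f) -> /le_trans ->.
Qed.

(** Expanding the right-hand side gives the sum of [u ^+ #|E|] over all subsets [E] of [K]; as
    [u <= 1], each set with at most [s] elements contributes at least [u ^+ s]. *)
Lemma card_small_sets (R : realType) (K : finType) (s : nat) (u : R) :
  0 <= u <= 1 ->
  #|[set E : {set K} | (#|E| <= s)%N]%SET|%:R * u ^+ s <= (1 + u) ^+ #|K|.
Proof.
move=> /andP[u0 u1].
have -> : (1 + u) ^+ #|K| = \sum_(E : {set K}) u ^+ #|E|.
  rewrite -prodr_const addrC bigA_distr; apply: eq_bigr => E _.
  by rewrite -prodr_const [RHS]big_mkcond.
rewrite mulr_natl -sumr_const [leLHS]big_mkcond/=; apply: ler_sum => E _.
by rewrite inE; case: ifP => [Es|_]; [exact: ler_wiXn2l|exact: exprn_ge0].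
Qed.

(** The sample and its ghost copy are recorded side by side, so that exchanging their [k]-th points
    merely swaps the two components at [k]. *)
Definition trace (T Q : finType) (n : nat) (b : Q -> T -> bool)
    (p : {ffun 'I_n -> T} * {ffun 'I_n -> T}) (q : Q) : {ffun 'I_n -> bool * bool} :=
  [ffun k => (b q (p.1 k), b q (p.2 k))].

(** Sample and ghost together are a family indexed by ['I_n * bool]. By [matches_hull] each trace is
    the image under [g] of an index set of size at most [2 * dbar], so there are no more traces than
    such sets. *)
Lemma card_trace_matches (R : realType) (dbar n : nat) (T Q : finType)
    (rep : T -> dbar.-tuple R) (qf : Q -> query R dbar) (u : R)
    (p : {ffun 'I_n -> T} * {ffun 'I_n -> T}) : (0 < dbar)%N -> 0 <= u <= 1 ->
  #|[set trace (fun q t => matches (qf q) (rep t)) p q | q in Q]%SET|%:R * u ^+ (2 * dbar)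
    <= (1 + u) ^+ (n * 2).
Proof.
move=> dbar_gt0 u01; pose K : finType := ('I_n * bool)%type.
pose y (k : K) := rep (if k.2 then p.2 k.1 else p.1 k.1).
pose hull (E : {set K}) k :=
  [forall j, [exists e in E, tnth (y e) j <= tnth (y k) j]
          && [exists e in E, tnth (y k) j <= tnth (y e) j]].
have cK : #|{: K}| = (n * 2)%N by rewrite card_prod card_ord card_bool.
rewrite -cK; apply: le_trans (card_small_sets _ (2 * dbar) u01).
apply: ler_wpM2r; first by case/andP: u01 => u0 _; exact: exprn_ge0.
rewrite ler_nat.
pose g (E : {set K}) : {ffun 'I_n -> bool * bool} :=
  [ffun k => (hull E (k, false), hull E (k, true))].
apply: leq_trans (leq_imset_card g _).
apply/subset_leq_card/fintype.subsetP => v /imsetP[q _ ->].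
have [E cE HE] := matches_hull y (qf q) dbar_gt0.
apply/imsetP; exists E; first by rewrite inE.
by apply/ffunP => k; rewrite !ffunE /hull -!HE.
Qed.

(** * Symmetrization and the Chernoff bound for a finite law *)

Definition swap (T : Type) (n : nat) (s : {ffun 'I_n -> bool})
    (p : {ffun 'I_n -> T} * {ffun 'I_n -> T}) : {ffun 'I_n -> T} * {ffun 'I_n -> T} :=
  ([ffun k => if s k then p.2 k else p.1 k], [ffun k => if s k then p.1 k else p.2 k]).

Lemma swapK (T : Type) (n : nat) (s : {ffun 'I_n -> bool}) : involutive (@swap T n s).
Proof.
by move=> [x y]; congr pair; apply/ffunP => k; rewrite /swap/= ffunE;
  case sk: (s k); rewrite ffunE sk.
Qed.

(** The sum runs over distinct traces rather than over queries, so the union bound costs only the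
    number of traces. Each exponent is [l] times the count on the sample minus the count on the
    ghost. *)
Definition trace_mgf (R : realType) (T Q : finType) (n : nat) (b : Q -> T -> bool)
    (l : R) (p : {ffun 'I_n -> T} * {ffun 'I_n -> T}) : R :=
  \sum_(v in [set trace b p q | q in Q]%SET)
    expR (\sum_k l * ((v k).1%:R - (v k).2%:R)).

(** Exchanging points acts on traces by the involution [sv], so the sum can be reindexed over the
    original traces; at each exchanged index the difference changes sign. *)
Lemma trace_mgf_swap (R : realType) (T Q : finType) (n : nat) (b : Q -> T -> bool)
    (l : R) (s : {ffun 'I_n -> bool}) (p : {ffun 'I_n -> T} * {ffun 'I_n -> T}) :
  trace_mgf b l (swap s p) = \sum_(v in [set trace b p q | q in Q]%SET)
    expR (\sum_k (-1) ^+ s k * (l * ((v k).1%:R - (v k).2%:R))).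
Proof.
pose sv (v : {ffun 'I_n -> bool * bool}) : {ffun 'I_n -> bool * bool} :=
  [ffun k => if s k then ((v k).2, (v k).1) else v k].
have svK : involutive sv.
  by move=> v; apply/ffunP => k; rewrite !ffunE; case: (s k); case: (v k).
have tE q : trace b (swap s p) q = sv (trace b p q).
  by apply/ffunP => k; rewrite !ffunE; case: (s k).
rewrite /trace_mgf (_ : imset _ _ = sv @: [set trace b p q | q in Q])%SET.
  rewrite big_imset/=; last by move=> v w _ _; exact: (inv_inj svK).
  apply: eq_bigr => v _; congr expR; apply: eq_bigr => k _.
  by rewrite ffunE; case: (s k) => /=; rewrite ?expr1 ?expr0; ring.
by rewrite -imset_comp; apply: eq_imset => q /=; exact: tE.
Qed.

(** The difference of the two booleans is 0, 1 or -1. For 1 and -1 equality holds; for 0 the sum is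
    2, and [1 + x <= expR x] at [l] and [- l] gives the bound. *)
Lemma sum_expR_sign (R : realType) (l : R) (v : bool * bool) :
  \sum_(s : bool) expR ((-1) ^+ s * (l * (v.1%:R - v.2%:R))) <= expR l + expR (- l).
Proof.
have e2 : 2 <= expR l + expR (- l).
  by have := expR_ge1Dx l; have := expR_ge1Dx (- l); lra.
rewrite big_bool expr1 expr0 mulN1r mul1r.
case: v => -[] [] /=; rewrite ?subrr ?subr0 ?sub0r ?mulr0 ?oppr0 ?expR0 ?mulr1 ?mulrN1 ?opprK//.
by rewrite addrC.
Qed.

(** For a fixed trace the sum over all sign vectors factorizes into [n] sums over a single sign. *)
Lemma sum_trace_mgf_swap (R : realType) (T Q : finType) (n : nat) (b : Q -> T -> bool)
    (l : R) (p : {ffun 'I_n -> T} * {ffun 'I_n -> T}) :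
  \sum_(s : {ffun 'I_n -> bool}) trace_mgf b l (swap s p)
    <= #|[set trace b p q | q in Q]%SET|%:R * (expR l + expR (- l)) ^+ n.
Proof.
under eq_bigr do rewrite trace_mgf_swap.
rewrite exchange_big/= mulr_natl -sumr_const; apply: ler_sum => v _.
under eq_bigr do rewrite expR_sum.
rewrite -(bigA_distr_bigA (fun k (s : bool) => expR ((-1) ^+ s * (l * ((v k).1%:R - (v k).2%:R))))).
rewrite -[X in _ ^+ X]card_ord -prodr_const; apply: ler_prod => k _.
by rewrite sum_expR_sign andbT; apply: sumr_ge0 => s _; exact: expR_ge0.
Qed.

(* Exchanging the [k]-th points of the sample and of its ghost copy preserves
   the product law, so one may average over all such exchanges. *)
Lemma expected_trace_mgf (R : realType) (T Q : finType) (n : nat) (b : Q -> T -> bool)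
    (mu : T -> R) (l C : R) :
  (forall t, 0 <= mu t) -> \sum_t mu t = 1 ->
  (forall p : {ffun 'I_n -> T} * {ffun 'I_n -> T},
    #|[set trace b p q | q in Q]%SET|%:R <= C) ->
  \sum_(p : {ffun 'I_n -> T} * {ffun 'I_n -> T})
     (\prod_k mu (p.1 k) * \prod_k mu (p.2 k)) * trace_mgf b l p
  <= C * ((expR l + expR (- l)) / 2) ^+ n.
Proof.
move=> mu0 mu1 HC.
pose W (p : {ffun 'I_n -> T} * {ffun 'I_n -> T}) := \prod_k mu (p.1 k) * \prod_k mu (p.2 k).
have W0 p : 0 <= W p by apply: mulr_ge0; apply: prodr_ge0.
have W1 : \sum_p W p = 1.
  rewrite -(pair_bigA _ (fun x y : {ffun 'I_n -> T} => \prod_k mu (x k) * \prod_k mu (y k)))/=.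
  have w1 : \sum_(x : {ffun 'I_n -> T}) \prod_k mu (x k) = 1.
    by rewrite -(bigA_distr_bigA (fun _ => mu)) big1.
  by under eq_bigr do rewrite -mulr_sumr w1 mulr1.
have WS s p : W (swap s p) = W p.
  rewrite /W -!big_split/=; apply: eq_bigr => k _.
  by rewrite !ffunE; case: (s k) => //; rewrite mulrC.
set S := \sum_p _.
have SE s : S = \sum_p W p * trace_mgf b l (swap s p).
  rewrite /S (reindex_inj (inv_inj (@swapK T n s)))/=.
  by apply: eq_bigr => p _; rewrite -[X in X * _]/(W (swap s p)) WS.
have : 2 ^+ n * S <= C * (expR l + expR (- l)) ^+ n.
  have -> : 2 ^+ n * S = \sum_(s : {ffun 'I_n -> bool}) S.
    by rewrite sumr_const card_ffun card_bool card_ord -natrX mulr_natl.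
  under eq_bigr => s do rewrite (SE s).
  rewrite exchange_big/= -[leRHS]mul1r -W1 mulr_suml; apply: ler_sum => p _.
  rewrite -mulr_sumr; apply: ler_wpM2l => //.
  apply: le_trans (sum_trace_mgf_swap _ _ _) _.
  by apply: ler_wpM2r (HC p); apply: exprn_ge0; apply: addr_ge0; exact: expR_ge0.
by rewrite expr_div_n mulrA ler_pdivlMr ?exprn_gt0// mulrC.
Qed.

(** The exponential lies above its tangent at the mean [a]; averaging the tangent gives exactly
    [expR a]. *)
Lemma jensen_expR (R : realType) (T : finType) (mu : T -> R) (f : T -> R) :
  (forall t, 0 <= mu t) -> \sum_t mu t = 1 ->
  expR (\sum_t mu t * f t) <= \sum_t mu t * expR (f t).
Proof.
move=> mu0 mu1; set a := \sum_t mu t * f t.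
have -> : expR a = \sum_t mu t * (expR a * (1 + (f t - a))).
  transitivity (expR a * (\sum_t mu t + (\sum_t mu t * f t - \sum_t mu t * a))).
    by rewrite -mulr_suml mu1 -/a; ring.
  rewrite -sumrB -big_split/= mulr_sumr.
  by apply: eq_bigr => t _; ring.
apply: ler_sum => t _; apply: ler_wpM2l => //.
have -> : expR (f t) = expR a * expR (f t - a) by rewrite -expRD subrKC.
by apply: ler_wpM2l; [exact: expR_ge0|exact: expR_ge1Dx].
Qed.

(** Jensen, applied separately to each index, replaces the mean by an independent ghost point. The
    resulting exponential is the term of [trace_mgf] at the trace of [q], and the other terms are
    nonnegative. *)
Lemma ghost_sample (R : realType) (T Q : finType) (n : nat) (b : Q -> T -> bool)
    (mu : T -> R) (l : R) (x : {ffun 'I_n -> T}) (q : Q) :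
  (forall t, 0 <= mu t) -> \sum_t mu t = 1 ->
  expR (l * (\sum_k (b q (x k))%:R - n%:R * \sum_t mu t * (b q t)%:R))
    <= \sum_(y : {ffun 'I_n -> T}) \prod_k mu (y k) * trace_mgf b l (x, y).
Proof.
move=> mu0 mu1.
apply: (@le_trans _ _ (\sum_(y : {ffun 'I_n -> T})
    \prod_k (mu (y k) * expR (l * ((b q (x k))%:R - (b q (y k))%:R))))); last first.
  apply: ler_sum => y _; rewrite big_split/=.
  apply: ler_wpM2l; first exact: prodr_ge0.
  rewrite -expR_sum /trace_mgf (bigD1 (trace b (x, y) q))/=; last exact: imset_f.
  rewrite -[leLHS]addr0 lerD//; last by apply: sumr_ge0 => *; exact: expR_ge0.
  by rewrite le_eqVlt; apply/orP; left; apply/eqP; congr expR; apply: eq_bigr => k _; rewrite ffunE.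
rewrite -(bigA_distr_bigA (fun k t => mu t * expR (l * ((b q (x k))%:R - (b q t)%:R)))).
set m := \sum_t mu t * _; have -> : n%:R * m = \sum_(k < n) m.
  by rewrite sumr_const card_ord mulr_natl.
rewrite -sumrB mulr_sumr expR_sum; apply: ler_prod => k _; rewrite expR_ge0/=.
apply: le_trans (jensen_expR _ mu0 mu1).
rewrite le_eqVlt; apply/orP; left; apply/eqP; congr expR.
under [RHS]eq_bigr do rewrite mulrCA mulrBr.
by rewrite -mulr_sumr sumrB -mulr_suml mu1 !mul1r.
Qed.

(** Markov's inequality for the exponential moment. The parameters [l] and [- l] control the two
    signs of the deviation, whence the factor 2. *)
Lemma finite_deviation (R : realType) (T Q : finType) (n : nat) (b : Q -> T -> bool)
    (mu : T -> R) (l a C : R) :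
  (forall t, 0 <= mu t) -> \sum_t mu t = 1 -> 0 <= l ->
  (forall p : {ffun 'I_n -> T} * {ffun 'I_n -> T},
    #|[set trace b p q | q in Q]%SET|%:R <= C) ->
  \sum_(x : {ffun 'I_n -> T} |
      [exists q, a < `|n%:R * \sum_t mu t * (b q t)%:R - \sum_k (b q (x k))%:R|])
    \prod_k mu (x k)
  <= expR (- (l * a)) * (2 * (C * ((expR l + expR (- l)) / 2) ^+ n)).
Proof.
move=> mu0 mu1 l0 HC.
pose G l (x : {ffun 'I_n -> T}) :=
  \sum_(y : {ffun 'I_n -> T}) \prod_k mu (y k) * trace_mgf b l (x, y).
have G0 l' x : 0 <= G l' x.
  apply: sumr_ge0 => y _; apply: mulr_ge0; first exact: prodr_ge0.
  by apply: sumr_ge0 => *; exact: expR_ge0.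
have EG l' : \sum_(x : {ffun 'I_n -> T}) \prod_k mu (x k) * G l' x =
    \sum_(p : {ffun 'I_n -> T} * {ffun 'I_n -> T})
     (\prod_k mu (p.1 k) * \prod_k mu (p.2 k)) * trace_mgf b l' p.
  rewrite -(pair_bigA _ (fun x y : {ffun 'I_n -> T} =>
    (\prod_k mu (x k) * \prod_k mu (y k)) * trace_mgf b l' (x, y)))/=.
  apply: eq_bigr => x _; rewrite mulr_sumr.
  by apply: eq_bigr => y _; rewrite mulrA.
apply: (@le_trans _ _ (expR (- (l * a)) *
  \sum_(x : {ffun 'I_n -> T}) \prod_k mu (x k) * (G l x + G (- l) x))); last first.
  apply: ler_wpM2l; first exact: expR_ge0.
  under eq_bigr do rewrite mulrDr.
  rewrite big_split/= !EG mulr_natl mulr2n; apply: lerD.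
    exact: expected_trace_mgf.
  by apply: le_trans (expected_trace_mgf _ mu0 mu1 HC) _; rewrite opprK [expR (- l) + _]addrC.
rewrite mulr_sumr big_mkcond; apply: ler_sum => x _.
have w0 : 0 <= \prod_k mu (x k) by exact: prodr_ge0.
case: ifP => [/existsP[q Hq]|_]; last first.
  by rewrite mulr_ge0 ?expR_ge0// mulr_ge0// addr_ge0.
rewrite mulrCA -[leLHS]mulr1; apply: ler_wpM2l => //.
rewrite -(expRxMexpNx_1 (l * a)) mulrC; apply: ler_wpM2l; first exact: expR_ge0.
set d := _ - _ in Hq.
apply: (@le_trans _ _ (expR (l * `|d|))); first by rewrite ler_expR ler_wpM2l// ltW.
have [d0|d0] := ger0P d.
  apply: (@le_trans _ _ (G (- l) x)); last by rewrite lerDr.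
  by rewrite -mulrNN opprB; exact: ghost_sample.
apply: (@le_trans _ _ (G l x)); last by rewrite lerDl.
by rewrite opprB; exact: ghost_sample.
Qed.

(** * Integrals of bounded and of finitely valued random variables *)

Lemma bounded_integrable (d : measure_display) (Omega : measurableType d) (R : realType)
    (P : probability Omega R) (B : R) (f : Omega -> R) :
  measurable_fun setT f -> (forall w, `|f w| <= B) -> P.-integrable setT (EFin \o f).
Proof.
move=> mf fB; apply: measurable_bounded_integrable => //.
  by rewrite (le_lt_trans (probability_le1 P _))// ltry.
exists B; split=> [|M BM w _]; first exact: num_real.
exact: le_trans (fB w) (ltW BM).
Qed.

Lemma Rintegral_probability_cst (d : measure_display) (Omega : measurableType d)
    (R : realType) (P : probability Omega R) (r : R) :
  Rintegral P setT (fun=> r) = r.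
Proof.
by rewrite Rintegral_cst// -[RHS]mulr1; congr (_ * _);
  exact: (congr1 (@fine R) (probability_setT P)).
Qed.

Lemma Rintegral_finite_sum (d : measure_display) (Omega : measurableType d) (R : realType)
    (P : probability Omega R) (I : Type) (s : seq I) (f : I -> Omega -> R) :
  (forall i, P.-integrable setT (EFin \o f i)) ->
  Rintegral P setT (fun w => \sum_(i <- s) f i w) = \sum_(i <- s) Rintegral P setT (f i).
Proof.
move=> If; rewrite /Rintegral.
under eq_integral do rewrite -sumEFin.
rewrite (@integral_sum _ _ _ _ _ _ _ (fun i w => (f i w)%:E))//.
by rewrite sum_fine// => i _; apply: integrable_fin_num => //; exact: If.
Qed.

Lemma finite_valuedE (R : realType) (Omega : Type) (F : finType) (Y : Omega -> F)
    (phi : F -> R) (w : Omega) :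
  phi (Y w) = \sum_(y : F) phi y * \1_(Y @^-1` [set y]) w.
Proof.
rewrite (bigD1 (Y w))//= big1 ?addr0 => [|y yY].
  by rewrite indicE mem_set// mulr1.
by rewrite indicE memNset ?mulr0//= => Yy; rewrite Yy eqxx in yY.
Qed.

Lemma measurable_finite_valued (d : measure_display) (Omega : measurableType d)
    (R : realType) (F : finType) (Y : Omega -> F) (phi : F -> R) :
  (forall y, measurable (Y @^-1` [set y])) ->
  measurable_fun setT (fun w => phi (Y w)).
Proof.
move=> mY; under eq_fun do rewrite finite_valuedE.
by apply: measurable_sum => y; apply: measurable_funM => //; exact: measurable_indic.
Qed.

Lemma Rintegral_finite_valued (d : measure_display) (Omega : measurableType d)
    (R : realType) (P : probability Omega R) (F : finType) (Y : Omega -> F) (phi : F -> R) :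
  (forall y, measurable (Y @^-1` [set y])) ->
  Rintegral P setT (fun w => phi (Y w)) = \sum_y phi y * fine (P (Y @^-1` [set y])).
Proof.
move=> mY; under eq_Rintegral do rewrite finite_valuedE.
have I1 y : P.-integrable setT (EFin \o \1_(Y @^-1` [set y])).
  apply: (@bounded_integrable _ _ _ _ 1); first exact: measurable_indic.
  by move=> w; rewrite indicE; case: (_ \in _); rewrite ?normr1 ?normr0.
rewrite Rintegral_finite_sum => [|y]; last exact: (integrableZl measurableT (phi y) (I1 y)).
apply: eq_bigr => y _; rewrite RintegralZl//; congr (_ * _).
by rewrite /Rintegral integral_indic// setIT.
Qed.

(** * From finite laws to an arbitrary law, for finitely many queries *)

Lemma measurable_matches (R : realType) (dbar : nat) (q : query R dbar) :
  measurable [set p | matches q p].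
Proof.
rewrite (_ : [set p | _] = \bigcap_(j in [set: 'I_dbar])
   ((fun p : dbar.-tuple R => tnth p j) @^-1` `[tnth q.1 j, (tnth q.1 j + tnth q.2 j)[)).
  apply: fin_bigcap_measurable => [|j _]; first exact: finite_finset.
  by rewrite -[X in measurable X]setTI; apply: measurable_tnth.
apply/seteqP; split => p /=.
  by move=> /forallP Hp j _ /=; rewrite in_itv/=; exact: Hp.
by move=> Hp; apply/forallP => j; have := Hp j I; rewrite /= in_itv.
Qed.

(** Finitely many queries see a point only through its pattern of memberships, so [chi] may be
    replaced by its image [mu] on the finite type of patterns, where [finite_deviation] applies. *)
Lemma fD_COUNT_finite_deviation (R : realType) (dbar n : nat) (m : 'I_dbar)
    (chi : probability (dbar.-tuple R) R)
    (d : measure_display) (Omega : measurableType d) (P : probability Omega R)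
    (X : 'I_n -> Omega -> dbar.-tuple R) (Q : finType) (qf : Q -> query R dbar) (l a u : R) :
  (forall k, measurable_fun [set: Omega] (X k)) ->
  (forall k, has_law P (X k) chi) -> mutually_independent P X ->
  0 <= l -> 0 < u <= 1 ->
  (P [set w | exists q, (a < `|Rintegral P setT (fun w => fD m COUNT (fun k => X k w) (qf q))
      - fD m COUNT (fun k => X k w) (qf q)|)%R]
  <= (expR (- (l * a)) * (2 * (u ^- (2 * dbar) * (1 + u) ^+ (n * 2)
        * ((expR l + expR (- l)) / 2) ^+ n)))%:E)%E.
Proof.
move=> mX lawX indX l0 /andP[u0 u1].
pose T : finType := {ffun Q -> bool}.
pose pat (p : dbar.-tuple R) : T := [ffun q => matches (qf q) p].
(* A pattern realized by no point gets the origin as representative. It has mass zero, but having a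
   point for every pattern lets [card_trace_matches] bound all traces. *)
pose rep (t : T) := xget [tuple 0 | _ < dbar] [set p | pat p = t].
have repE p q : matches (qf q) (rep (pat p)) = matches (qf q) p.
  have /= := @xgetPex _ [tuple 0 | _ < dbar] [set p' | pat p' = pat p]
    (ex_intro _ p erefl).
  by move=> /ffunP/(_ q); rewrite !ffunE.
pose b q t := matches (qf q) (rep t).
have mpat (t : T) : measurable (pat @^-1` [set t]).
  rewrite (_ : _ @^-1` _ = \bigcap_(q in [set: Q]) [set p | matches (qf q) p = t q]).
    apply: fin_bigcap_measurable => [|q _]; first exact: finite_finset.
    case: (t q); first exact: measurable_matches.
    rewrite (_ : [set p | _] = ~` [set p | matches (qf q) p]).
      by apply: measurableC; exact: measurable_matches.
    by apply/seteqP; split => p /= => [-> //|/negP/negbTE].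
  apply/seteqP; split => p /= => [<- q _ /=|Hp]; first by rewrite ffunE.
  by apply/ffunP => q; rewrite ffunE; exact: Hp.
pose mu t := fine (chi (pat @^-1` [set t])).
have mXpat k t : measurable ((fun w => pat (X k w)) @^-1` [set t]).
  rewrite -[X in measurable X]setTI; exact: (mX k measurableT _ (mpat t)).
have PXpat k t : P ((fun w => pat (X k w)) @^-1` [set t]) = chi (pat @^-1` [set t]).
  exact: lawX.
have mu0 t : 0 <= mu t by exact: fine_ge0.
have mu1 : \sum_t mu t = 1.
  transitivity (Rintegral chi setT (fun=> 1)).
    by rewrite (@Rintegral_finite_valued _ _ _ chi T pat (fun=> 1))//;
      apply: eq_bigr => t _; rewrite mul1r.
  exact: Rintegral_probability_cst.
have Eq q : Rintegral P setT (fun w => fD m COUNT (fun k => X k w) (qf q)) =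
    n%:R * \sum_t mu t * (b q t)%:R.
  rewrite [LHS](@Rintegral_finite_sum _ _ _ _ _ _ (fun k w => (matches (qf q) (X k w))%:R)).
    rewrite (eq_bigr (fun=> \sum_t mu t * (b q t)%:R)) ?sumr_const ?card_ord ?mulr_natl// => k _.
    under eq_Rintegral do rewrite -repE.
    rewrite (@Rintegral_finite_valued _ _ _ _ _ _ (fun t => (b q t)%:R))//.
    by apply: eq_bigr => t _; rewrite PXpat mulrC.
  move=> k; apply: (@bounded_integrable _ _ _ _ 1) => [|w]; last first.
    by case: (matches _ _); rewrite ?normr1 ?normr0.
  under eq_fun do rewrite -repE.
  exact: (@measurable_finite_valued _ _ _ _ _ (fun t => (b q t)%:R)).
pose Y w : {ffun 'I_n -> T} := [ffun k => pat (X k w)].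
have YE x : Y @^-1` [set x] = \bigcap_(k in [set: 'I_n]) (X k @^-1` (pat @^-1` [set x k])).
  apply/seteqP; split => w /= => [<- k _ /=|Hw]; first by rewrite ffunE.
  by apply/ffunP => k; rewrite ffunE; exact: Hw.
have mY x : measurable (Y @^-1` [set x]).
  rewrite YE; apply: fin_bigcap_measurable => [|k _]; first exact: finite_finset.
  exact: mXpat.
(* Independence enters here: the vector of patterns has the product law. *)
have PY x : fine (P (Y @^-1` [set x])) = \prod_k mu (x k).
  rewrite YE indX => [|//]; rewrite (eq_bigr (fun k => (mu (x k))%:E)) => [|k _].
    by rewrite prodEFin.
  by rewrite lawX// fineK// fin_num_measure.
pose bad (x : {ffun 'I_n -> T}) :=
  [exists q, a < `|n%:R * \sum_t mu t * (b q t)%:R - \sum_k (b q (x k))%:R|].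
have -> : [set w | exists q, (a < `|Rintegral P setT (fun w => fD m COUNT (fun k => X k w) (qf q))
      - fD m COUNT (fun k => X k w) (qf q)|)%R] = [set w | bad (Y w)].
  apply: eq_set => w; apply/propext; split.
    move=> [q]; rewrite Eq => Hq; apply/existsP; exists q; move: Hq.
    by under [X in _ -> is_true (_ < `|_ - X|)]eq_bigr do rewrite ffunE /b repE.
  move=> /existsP[q Hq]; exists q; rewrite Eq; move: Hq.
  by under [X in is_true (_ < `|_ - X|) -> _]eq_bigr do rewrite ffunE /b repE.
have mbad : measurable [set w | bad (Y w)].
  have := @measurable_finite_valued _ _ R _ Y (fun x => (bad x)%:R) mY.
  move=> /(_ measurableT [set 1] (measurable_set1 _)); rewrite setTI.
  congr (measurable _); apply/seteqP; split => w /=; case: (bad (Y w)) => //.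
  by move=> /eqP; rewrite eq_sym oner_eq0.
rewrite -[X in (X <= _)%E]fineK ?fin_num_measure// lee_fin.
have -> : fine (P [set w | bad (Y w)]) = \sum_(x | bad x) \prod_k mu (x k).
  transitivity (Rintegral P setT (fun w => (bad (Y w))%:R)).
    rewrite /Rintegral -[in LHS](setIT [set w | bad (Y w)]) -integral_indic//.
    by congr fine; apply: eq_integral => w _; rewrite indicE mem_setE.
  rewrite (@Rintegral_finite_valued _ _ _ P _ Y (fun x => (bad x)%:R))// [RHS]big_mkcond.
  apply: eq_bigr => x _.
  by rewrite PY; case: (bad x); rewrite ?mul1r ?mul0r.
apply: finite_deviation => // p.
rewrite [leRHS]mulrC ler_pdivlMr ?exprn_gt0//; apply: card_trace_matches.
  exact: leq_ltn_trans (ltn_ord m).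
by rewrite ltW.
Qed.

(** * Bounds and measurability of the query functions *)

Lemma fDE (R : realType) (dbar n : nat) (m : 'I_dbar) (i : aggr)
    (D : 'I_n -> dbar.-tuple R) (q : query R dbar) :
  fD m i D q =
    \sum_(k < n) (matches q (D k))%:R * (if i is SUM then tnth (D k) m else 1).
Proof. by case: i => //=; apply: eq_bigr => k _; rewrite mulr1. Qed.

Lemma matches_itv01 (R : realType) (dbar : nat) (q : query R dbar) (p : dbar.-tuple R)
    (j : 'I_dbar) : Qspace q -> matches q p -> 0 <= tnth p j < 1.
Proof.
move=> /(_ j)[/andP[c0 _] [_ cr1]] /forallP/(_ j)/andP[cp pcr].
by rewrite (le_trans c0 cp) (lt_le_trans pcr cr1).
Qed.

(** A query box lies in the unit cube, so for SUM as for COUNT each point adds a value in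
    [[0, 1]]. *)
Lemma fD_bound (R : realType) (dbar n : nat) (m : 'I_dbar) (i : aggr)
    (D : 'I_n -> dbar.-tuple R) (q : query R dbar) :
  Qspace q -> 0 <= fD m i D q <= n%:R.
Proof.
move=> Qq; rewrite fDE -[X in _ <= X%:R]card_ord -sumr_const.
have H k : 0 <= (matches q (D k))%:R * (if i is SUM then tnth (D k) m else 1) <= 1.
  case: (boolP (matches q _)) => [/(matches_itv01 m Qq)/andP[p0 /ltW p1]|_].
    by rewrite mul1r; case: i; rewrite ?p0 ?p1 ?ler01 ?lexx.
  by rewrite mul0r lexx ler01.
apply/andP; split; first by apply: sumr_ge0 => k _; case/andP: (H k).
by apply: ler_sum => k _; case/andP: (H k).
Qed.

Lemma measurable_fD (R : realType) (dbar n : nat) (m : 'I_dbar) (i : aggr)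
    (d : measure_display) (Omega : measurableType d) (X : 'I_n -> Omega -> dbar.-tuple R)
    (q : query R dbar) :
  (forall k, measurable_fun [set: Omega] (X k)) ->
  measurable_fun setT (fun w => fD m i (fun k => X k w) q).
Proof.
move=> mX; under eq_fun do rewrite fDE.
apply: measurable_sum => k.
pose F (p : dbar.-tuple R) : R :=
  \1_[set p | matches q p] p * (if i is SUM then tnth p m else 1).
rewrite (_ : (fun w => _) = F \o X k); last first.
  apply/funext => w; rewrite /F/= indicE; congr (_%:R * _).
  by case: (boolP (matches q _)) => H; [rewrite mem_set|rewrite memNset//; exact/negP].
apply: measurableT_comp => //; apply: measurable_funM.
  by apply: measurable_indic; exact: measurable_matches.
by case: i @F => F //; exact: measurable_tnth.
Qed.

Lemma fD_integrable (R : realType) (dbar n : nat) (m : 'I_dbar) (i : aggr)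
    (d : measure_display) (Omega : measurableType d) (P : probability Omega R)
    (X : 'I_n -> Omega -> dbar.-tuple R) (q : query R dbar) :
  (forall k, measurable_fun [set: Omega] (X k)) -> Qspace q ->
  P.-integrable setT (EFin \o (fun w => fD m i (fun k => X k w) q)).
Proof.
move=> mX Qq; apply: (@bounded_integrable _ _ _ _ n%:R); first exact: measurable_fD.
by move=> w; have /andP[f0 f1] := fD_bound m i (fun k => X k w) Qq; rewrite ger0_norm.
Qed.

(** * Reduction from all queries to finite grids *)

(** A side is given by the indices of its two ends on a grid of mesh [1 / N.+1]; the [N.+2] indices
    include both 0 and 1. Truncated subtraction gives width 0 to reversed ends, so every [a] yields
    a query of [Qspace]. *)
Definition grid_query (R : realType) (dbar N : nat)
    (a : {ffun 'I_dbar -> 'I_N.+2 * 'I_N.+2}) : query R dbar :=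
  ([tuple (a j).1%:R / N.+1%:R | j < dbar],
   [tuple ((a j).2 - (a j).1)%N%:R / N.+1%:R | j < dbar]).

Lemma grid_query_Qspace (R : realType) (dbar N : nat)
    (a : {ffun 'I_dbar -> 'I_N.+2 * 'I_N.+2}) : Qspace (grid_query R a).
Proof.
move=> j; rewrite !tnth_mktuple -mulrDl -natrD.
have H (k : nat) : (k <= N.+1)%N -> 0 <= (k%:R / N.+1%:R : R) <= 1.
  by move=> kN; rewrite divr_ge0//= ler_pdivrMr ?ltr0Sn// mul1r ler_nat.
have := ltn_ord (a j).1; have := ltn_ord (a j).2; rewrite !ltnS => b2 b1.
split; first exact: H.
split; first by apply: H; rewrite (leq_trans (leq_subr _ _)).
have b3 : ((a j).1 + ((a j).2 - (a j).1) <= N.+1)%N by rewrite -maxnE geq_max b1.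
by have /andP[] := H _ b3.
Qed.

(** Rounding [x] down preserves [x <= y]; if [y < x], it cannot cross the gap once the mesh is below
    [x - y]. *)
Lemma near_truncn_le (R : realType) (x y : R) : 0 <= x ->
  \forall N \near \oo, ((Num.truncn (x * N.+1%:R))%:R / N.+1%:R <= y) = (x <= y).
Proof.
move=> x0; have [xy|yx] := leP x y.
  apply: nearW => N; apply/idP; rewrite ler_pdivrMr ?ltr0Sn//.
  rewrite (@le_trans _ _ (x * N.+1%:R)) ?truncn_le ?mulr_ge0//.
  by rewrite ler_wpM2r.
have xy0 : 0 < x - y by rewrite subr_gt0.
near=> N.
apply/negbTE; rewrite -ltNge ltr_pdivlMr ?ltr0Sn//.
have /andP[_ H] := truncn_itv (mulr_ge0 x0 (ler0n R N.+1)).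
have HN : N.+1%:R^-1 < (PosNum xy0)%:num by near: N; exact: near_infty_natSinv_lt.
have : 1 < (x - y) * N.+1%:R by rewrite -ltr_pdivrMr ?ltr0Sn// div1r.
by move: H; rewrite -natr1; lra.
Unshelve. all: by end_near.
Qed.

(* Rounding [c] and [c + r] down is harmless since the indicator of [c <= x < c + r]
   is left-continuous in both [c] and [c + r]. *)
Lemma grid_query_approx (R : realType) (dbar : nat) (q : query R dbar) : Qspace q ->
  exists a : forall N, {ffun 'I_dbar -> 'I_N.+2 * 'I_N.+2},
    forall p, \forall N \near \oo, matches (grid_query R (a N)) p = matches q p.
Proof.
move=> Qq; pose tr (N : nat) (x : R) := Num.truncn (x * N.+1%:R).
exists (fun N => [ffun j => (inord (tr N (tnth q.1 j)),
                             inord (tr N (tnth q.1 j + tnth q.2 j)))]) => p.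
(* This bound keeps [inord] from falling back on its default index. *)
have tr_ord N x : 0 <= x <= 1 -> (tr N x < N.+2)%N.
  move=> /andP[x0 x1]; rewrite truncn_lt_nat ?mulr_ge0//.
  by rewrite (@le_lt_trans _ _ N.+1%:R) ?ltr_nat// ler_piMl.
have Hj : \forall N \near \oo, forall j : 'I_dbar,
    (((tr N (tnth q.1 j))%:R / N.+1%:R <= tnth p j) = (tnth q.1 j <= tnth p j)) /\
    (((tr N (tnth q.1 j + tnth q.2 j))%:R / N.+1%:R <= tnth p j)
      = (tnth q.1 j + tnth q.2 j <= tnth p j)).
  apply: filter_forall => j; have [/andP[c0 _] [/andP[r0 _] _]] := Qq j.
  by apply: filterI; apply: near_truncn_le; rewrite ?addr_ge0.
move: Hj; apply: filterS => N Hj.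
apply: eq_forallb => j; have [Hc Hr] := Hj j.
have [c01 [/andP[r0 _] cr1]] := Qq j; have /andP[c0 c1] := c01.
rewrite !tnth_mktuple ffunE/= !inordK ?tr_ord ?cr1 ?addr_ge0//.
rewrite Hc; congr (_ && _); rewrite -mulrDl -natrD subnKC.
  by rewrite ltNge Hr -ltNge.
by apply: le_truncn; rewrite ler_wpM2r// lerDl.
Qed.

Definition deviation (R : realType) (dbar n : nat) (m : 'I_dbar) (i : aggr)
    (d : measure_display) (Omega : measurableType d) (P : probability Omega R)
    (X : 'I_n -> Omega -> dbar.-tuple R) (w : Omega) (q : query R dbar) : R :=
  Rintegral P setT (fun w => fD m i (fun k => X k w) q) - fD m i (fun k => X k w) q.

(** At a fixed outcome there are only [n] points, so the observed values are eventually constant;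
    the expectations converge by dominated convergence with bound [n]. *)
Lemma deviation_cvg (R : realType) (dbar n : nat) (m : 'I_dbar) (i : aggr)
    (d : measure_display) (Omega : measurableType d) (P : probability Omega R)
    (X : 'I_n -> Omega -> dbar.-tuple R) (q : query R dbar) (qN : nat -> query R dbar) :
  (forall k, measurable_fun [set: Omega] (X k)) ->
  (forall N, Qspace (qN N)) -> Qspace q ->
  (forall p, \forall N \near \oo, matches (qN N) p = matches q p) ->
  forall w, deviation m i P X w (qN N) @[N --> \oo] --> deviation m i P X w q.
Proof.
move=> mX QN Qq Hq.
have fD_near w : \forall N \near \oo,
    fD m i (fun k => X k w) q = fD m i (fun k => X k w) (qN N).
  have : \forall N \near \oo, forall k, matches (qN N) (X k w) = matches q (X k w).
    by apply: filter_forall => k; exact: Hq.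
  by apply: filterS => N HN; rewrite !fDE; apply: eq_bigr => k _; rewrite HN.
move=> w; have fD_cvg v : fD m i (fun k => X k v) (qN N) @[N --> \oo] --> fD m i (fun k => X k v) q.
  by apply: cvg_near_cst; apply: filterS (fD_near v) => N ->.
apply: cvgB => //.
apply: fine_cvg; rewrite fineK; last first.
  by apply: integrable_fin_num => //; exact: fD_integrable.
have [| | | | |_ _ /= DC] := @dominated_convergence _ _ _ P setT measurableT
  (fun N w => (fD m i (fun k => X k w) (qN N))%:E)
  (fun w => (fD m i (fun k => X k w) q)%:E) (cst n%:R%:E).
- by move=> N; apply/measurable_EFinP; exact: measurable_fD.
- by apply/measurable_EFinP; exact: measurable_fD.
- by apply/nearW => v _; apply: cvg_EFin (fD_cvg v); apply: nearW.
- by apply: (@bounded_integrable _ _ _ _ n%:R (cst n%:R)) => // w'; rewrite normr_nat.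
- apply/nearW => w' N _; have /andP[f0 f1] := fD_bound m i (fun k => X k w') (QN N).
  by rewrite /= lee_fin ger0_norm.
- exact: DC.
Qed.

(** A strict inequality at [q] persists for all sufficiently fine grid approximations. The
    uncountable union over queries thus becomes a countable limit inferior of grid events. *)
Lemma deviation_event_grid (R : realType) (dbar n : nat) (m : 'I_dbar) (i : aggr)
    (d : measure_display) (Omega : measurableType d) (P : probability Omega R)
    (X : 'I_n -> Omega -> dbar.-tuple R) (a : R) :
  (forall k, measurable_fun [set: Omega] (X k)) ->
  [set w | exists2 q, Qspace q & a < `|deviation m i P X w q|] =
  \bigcup_M \bigcap_(N in [set N | (M <= N)%N])
    [set w | exists g : {ffun 'I_dbar -> 'I_N.+2 * 'I_N.+2},
      a < `|deviation m i P X w (grid_query R g)|].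
Proof.
move=> mX; apply/seteqP; split => w /=.
  move=> [q Qq aq]; have [g Hg] := grid_query_approx Qq.
  have := @deviation_cvg R dbar n m i d Omega P X q (fun N => grid_query R (g N)) mX
    (fun N => grid_query_Qspace R (g N)) Qq Hg w.
  move=> /cvg_norm/cvgr_gt/(_ a aq)[M _ HM].
  by exists M => // N MN; exists (g N); exact: HM.
move=> [M _ /(_ M)/= []//= g Hg].
by exists (grid_query R g) => //; exact: grid_query_Qspace.
Qed.

Lemma measurable_deviation_grid (R : realType) (dbar n N : nat) (m : 'I_dbar) (i : aggr)
    (d : measure_display) (Omega : measurableType d) (P : probability Omega R)
    (X : 'I_n -> Omega -> dbar.-tuple R) (a : R) :
  (forall k, measurable_fun [set: Omega] (X k)) ->
  measurable [set w | exists g : {ffun 'I_dbar -> 'I_N.+2 * 'I_N.+2},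
      a < `|deviation m i P X w (grid_query R g)|].
Proof.
move=> mX; rewrite (_ : [set w | _] =
  \bigcup_(g in [set: {ffun 'I_dbar -> 'I_N.+2 * 'I_N.+2}])
    [set w | a < `|deviation m i P X w (grid_query R g)|]); last first.
  by apply/seteqP; split => w /= [g] => [Hg|_ Hg]; exists g.
apply: fin_bigcup_measurable => [|g _]; first exact: finite_finset.
have mD : measurable_fun setT (fun w => `|deviation m i P X w (grid_query R g)|).
  apply: measurableT_comp => //; apply: measurable_funB => //.
  exact: measurable_fD.
have := mD measurableT _ (measurable_itv `]a, +oo[).
rewrite setTI; congr (measurable _).
by apply/seteqP; split => w /=; rewrite in_itv/= andbT.
Qed.

Lemma measurable_deviation_event (R : realType) (dbar n : nat) (m : 'I_dbar) (i : aggr)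
    (d : measure_display) (Omega : measurableType d) (P : probability Omega R)
    (X : 'I_n -> Omega -> dbar.-tuple R) (a : R) :
  (forall k, measurable_fun [set: Omega] (X k)) ->
  measurable [set w | exists2 q, Qspace q & a < `|deviation m i P X w q|].
Proof.
move=> mX; rewrite deviation_event_grid//; apply: bigcup_measurable => M _.
by apply: bigcap_measurableType => N _; exact: measurable_deviation_grid.
Qed.

(** The intersections [F M] increase with [M], and each lies in the grid event of index [M];
    continuity from below passes the uniform bound to their union. *)
Lemma deviation_event_le (R : realType) (dbar n : nat) (m : 'I_dbar) (i : aggr)
    (d : measure_display) (Omega : measurableType d) (P : probability Omega R)
    (X : 'I_n -> Omega -> dbar.-tuple R) (a : R) (b : \bar R) :
  (forall k, measurable_fun [set: Omega] (X k)) ->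
  (forall N, P [set w | exists g : {ffun 'I_dbar -> 'I_N.+2 * 'I_N.+2},
      (a < `|deviation m i P X w (grid_query R g)|)%R] <= b)%E ->
  (P [set w | exists2 q, Qspace q & (a < `|deviation m i P X w q|)%R] <= b)%E.
Proof.
move=> mX Hb; have mE := measurable_deviation_event m i P a mX.
rewrite deviation_event_grid// in mE *.
set F := fun M => _ in mE *.
have mF M : measurable (F M).
  by apply: bigcap_measurableType => N _; exact: measurable_deviation_grid.
have ndF : {homo F : M N / (M <= N)%N >-> (M <= N)%O}.
  move=> M N MN; apply/subsetPset => w Fw K /= NK.
  by apply: Fw => /=; exact: leq_trans NK.
have := @nondecreasing_cvg_mu _ _ _ P _ mF mE ndF.
move=> /cvg_lim <- //; apply: lime_le.
  by apply: (cvgP _ (nondecreasing_cvg_mu mF mE ndF)).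
apply: nearW => M /=; apply: le_trans (Hb M); apply: le_measure; rewrite ?inE//.
  exact: measurable_deviation_grid.
by move=> w /(_ M (leqnn M)).
Qed.

(** * From COUNT to SUM by slicing boxes *)

(** Side [m] keeps its upper end while its lower end is raised to at least [x]; the maximum with 0
    makes the side empty when the level passes the upper end. *)
Definition slice_query (R : realType) (dbar : nat) (m : 'I_dbar) (q : query R dbar)
    (x : R) : query R dbar :=
  ([tuple if j == m then Num.max (tnth q.1 j) x else tnth q.1 j | j < dbar],
   [tuple if j == m then Num.max 0 (tnth q.1 j + tnth q.2 j - Num.max (tnth q.1 j) x)
          else tnth q.2 j | j < dbar]).

Lemma slice_query_Qspace (R : realType) (dbar : nat) (m : 'I_dbar) (q : query R dbar)
    (x : R) : Qspace q -> 0 <= x <= 1 -> Qspace (slice_query m q x).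
Proof.
move=> Qq /andP[x0 x1] j; have [/andP[c0 c1] [/andP[r0 r1] cr]] := Qq j.
rewrite !tnth_mktuple; case: eqVneq => _; last by rewrite c0 c1 r0 r1.
have M0 : 0 <= Num.max (tnth q.1 j) x by rewrite le_max c0.
have M1 : Num.max (tnth q.1 j) x <= 1 by rewrite ge_max c1.
rewrite M0 M1; split=> //.
have [h|h] := leP 0 (tnth q.1 j + tnth q.2 j - Num.max (tnth q.1 j) x).
  by split; [apply/andP; split|]; lra.
by split; [apply/andP; split|]; lra.
Qed.

Lemma matches_slice (R : realType) (dbar : nat) (m : 'I_dbar) (q : query R dbar)
    (x : R) (p : dbar.-tuple R) :
  matches (slice_query m q x) p = matches q p && (x <= tnth p m).
Proof.
have mE (c r y : R) :
    (Num.max c x <= y) && (y < Num.max c x + Num.max 0 (c + r - Num.max c x)) =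
    ((c <= y) && (y < c + r)) && (x <= y).
  rewrite ge_max; have [xy|] := leP x y; last by rewrite !andbF.
  have [cy|] := leP c y; last by [].
  rewrite !andbT/=; have mxy : Num.max c x <= y by rewrite ge_max cy.
  have [h|h] := leP 0 (c + r - Num.max c x); first by rewrite [X in y < X]addrC subrK.
  by rewrite addr0; apply/idP/idP; move: mxy h; lra.
apply/forallP/andP => [H|[/forallP H xp] j].
  split; last by have := H m; rewrite !tnth_mktuple eqxx mE => /andP[].
  apply/forallP => j; have := H j; rewrite !tnth_mktuple.
  by case: eqP => _ //; rewrite mE => /andP[].
rewrite !tnth_mktuple; case: eqVneq => [->|_]; last exact: H.
by rewrite mE H.
Qed.

(** The number of levels [s.+1 / M] not exceeding [x] is the integer part of [x * M], so the average
    is [x] rounded down to a multiple of [1 / M]. *)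
Lemma sum_levels (R : realType) (M : nat) (x : R) : (0 < M)%N -> 0 <= x <= 1 ->
  `|x - M%:R^-1 * \sum_(s < M) (s.+1%:R / M%:R <= x)%R%:R| <= M%:R^-1.
Proof.
move=> M0 /andP[x0 x1]; have M0' : 0 < M%:R :> R by rewrite ltr0n.
have xM0 : 0 <= x * M%:R by rewrite mulr_ge0// ltW.
have tM : (Num.truncn (x * M%:R) <= M)%N.
  by rewrite -(ler_nat R) (le_trans _ (ler_piMl (ltW M0') x1))// truncn_le.
have -> : \sum_(s < M) (s.+1%:R / M%:R <= x)%R%:R = (Num.truncn (x * M%:R))%:R :> R.
  rewrite -[in RHS](card_ord (Num.truncn _)) -sum1_card natr_sum.
  rewrite (big_ord_widen _ (fun=> 1) tM) [RHS]big_mkcond; apply: eq_bigr => s _.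
  by rewrite ler_pdivrMr// truncn_gt_nat; case: (_ <= _).
have /andP[t1 t2] := truncn_itv xM0; rewrite -natr1 in t2.
have -> : x - M%:R^-1 * (Num.truncn (x * M%:R))%:R =
    M%:R^-1 * (x * M%:R - (Num.truncn (x * M%:R))%:R).
  by rewrite mulrBr mulrCA mulVf ?mulr1// gt_eqF.
rewrite ger0_norm; last by rewrite mulr_ge0 ?invr_ge0 ?ler0n// subr_ge0.
by rewrite ler_piMr ?invr_ge0 ?ler0n//; lra.
Qed.

Lemma fD_SUM_slices (R : realType) (dbar n M : nat) (m : 'I_dbar)
    (D : 'I_n -> dbar.-tuple R) (q : query R dbar) : (0 < M)%N -> Qspace q ->
  `|fD m SUM D q -
    M%:R^-1 * \sum_(s < M) fD m COUNT D (slice_query m q (s.+1%:R / M%:R))|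
  <= n%:R / M%:R.
Proof.
move=> M0 Qq; rewrite /fD exchange_big/= mulr_sumr -sumrB.
rewrite (le_trans (ler_norm_sum _ _ _))//.
have -> : n%:R / M%:R = \sum_(k < n) M%:R^-1 :> R by rewrite sumr_const card_ord mulr_natl.
apply: ler_sum => k _.
under eq_bigr do rewrite matches_slice.
case: (boolP (matches q (D k))) => [/(matches_itv01 m Qq)/andP[p0 /ltW p1]|_] /=.
  by rewrite mul1r; apply: sum_levels => //; rewrite p0 p1.
by rewrite big1// mul0r mulr0 subr0 normr0 invr_ge0.
Qed.

(* Layer cake: [p_m] is the average over the levels [x] of the indicator of
   [x <= p_m], and cutting a box at such a level yields a box. *)
Lemma deviation_SUM_le (R : realType) (dbar n : nat) (m : 'I_dbar)
    (d : measure_display) (Omega : measurableType d) (P : probability Omega R)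
    (X : 'I_n -> Omega -> dbar.-tuple R) (a : R) (w : Omega) :
  (forall k, measurable_fun [set: Omega] (X k)) ->
  (forall q, Qspace q -> `|deviation m COUNT P X w q| <= a) ->
  forall q, Qspace q -> `|deviation m SUM P X w q| <= a.
Proof.
move=> mX Ha q Qq; apply/ler_addgt0Pr => e e0.
(* Discretization costs [n / M] in the expectation and [n / M] in the sample, so [M] is taken with
   [1 / M < e / (2 * n).+1]; the successor keeps the denominator positive. *)
have [N _ /(_ N (leqnn N)) /= HN] :=
  near_infty_natSinv_lt (PosNum (divr_gt0 e0 (ltr0Sn R (2 * n)))).
set M := N.+1 in HN.
pose qs (s : 'I_M) := slice_query m q (s.+1%:R / M%:R).
have Qs s : Qspace (qs s).
  apply: slice_query_Qspace => //.
  by rewrite divr_ge0//= ler_pdivrMr ?ltr0Sn// mul1r ler_nat.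
pose f v := fD m SUM (fun k => X k v) q.
pose g v := M%:R^-1 * \sum_(s < M) fD m COUNT (fun k => X k v) (qs s).
have If : P.-integrable setT (EFin \o f) by exact: fD_integrable.
have Igs : P.-integrable setT
    (EFin \o (fun v => \sum_(s < M) fD m COUNT (fun k => X k v) (qs s))).
  rewrite (_ : EFin \o _ = fun v => (\sum_(s < M) (fD m COUNT (fun k => X k v) (qs s))%:E)%E).
    by apply: integrable_sum => // s _; exact: fD_integrable.
  by apply/funext => v /=; rewrite sumEFin.
have Ig : P.-integrable setT (EFin \o g) by exact: (integrableZl measurableT (M%:R^-1) Igs).
have fg v : `|f v - g v| <= n%:R / M%:R by exact: fD_SUM_slices.
have Eg : Rintegral P setT g =
    M%:R^-1 * \sum_(s < M) Rintegral P setT (fun v => fD m COUNT (fun k => X k v) (qs s)).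
  rewrite /g RintegralZl// Rintegral_finite_sum// => s.
  exact: fD_integrable.
have Ifg : P.-integrable setT (EFin \o (f \- g)) by exact: (integrableB measurableT If Ig).
have Efg : `|Rintegral P setT (f \- g)| <= n%:R / M%:R.
  apply: le_trans (le_normr_Rintegral measurableT Ifg) _.
  apply: (@le_trans _ _ (Rintegral P setT (fun=> n%:R / M%:R))).
    apply: le_Rintegral => //; [exact: (integrable_norm Ifg)| |by move=> v _; exact: fg].
    apply: (@bounded_integrable _ _ _ _ (n%:R / M%:R)) => // v.
    by rewrite ger0_norm// divr_ge0.
  by rewrite Rintegral_probability_cst.
have -> : deviation m SUM P X w q =
   M%:R^-1 * (\sum_(s < M) deviation m COUNT P X w (qs s)) +
   (Rintegral P setT (f \- g) - (f w - g w)).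
  rewrite /deviation sumrB mulrBr -Eg -/(g w) (RintegralB measurableT If Ig) /f.
  by ring.
rewrite (le_trans (ler_normD _ _))// lerD//.
  rewrite normrM ger0_norm ?invr_ge0// ler_pdivrMl ?ltr0Sn//.
  rewrite (le_trans (ler_norm_sum _ _ _))//.
  have -> : M%:R * a = \sum_(s < M) a by rewrite sumr_const card_ord mulr_natl.
  by apply: ler_sum => s _; exact: Ha.
rewrite (le_trans (ler_normB _ _))// (le_trans (lerD Efg (fg w)))//.
move: HN; rewrite ltr_pdivlMr ?ltr0Sn// => /ltW HN; apply: le_trans HN.
rewrite -mulrDl mulrC ler_wpM2l ?invr_ge0// -natrD ler_nat; lia.
Qed.

(** * The tail bound and the choice of constants *)

(** The bounds [(1 - l)^-1] and [(1 + l)^-1] on the two exponentials add up to [2 / (1 - l ^+ 2)],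
    which is at most [2 * (1 + 2 * l ^+ 2)] as [l ^+ 2 <= 1 / 2]. *)
Lemma cosh_le (R : realType) (l : R) : 0 <= l <= 1 / 2 ->
  (expR l + expR (- l)) / 2 <= expR (2 * l ^+ 2).
Proof.
move=> /andP[l0 l1]; apply: le_trans (expR_ge1Dx _).
have HE : expR l <= (1 - l)^-1.
  rewrite -[expR l]invrK -expRN lef_pV2 ?posrE ?expR_gt0//; first exact: expR_ge1Dx.
  by lra.
have HF : expR (- l) <= (1 + l)^-1.
  rewrite expRN lef_pV2 ?posrE ?expR_gt0//; first exact: expR_ge1Dx.
  by lra.
have : (1 - l)^-1 + (1 + l)^-1 <= 2 * (1 + 2 * l ^+ 2); last by lra.
have -> : (1 - l)^-1 + (1 + l)^-1 = 2 / (1 - l ^+ 2) by field; rewrite !gt_eqF//; nra.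
rewrite ler_pdivrMr; last by nra.
have : 0 <= l ^+ 2 <= 1 / 2 by apply/andP; split; nra.
by move: (l ^+ 2) => t /andP[t0 t1]; nra.
Qed.

Lemma deviation_bound (R : realType) (dbar n : nat) (m : 'I_dbar) (i : aggr)
    (d : measure_display) (Omega : measurableType d) (P : probability Omega R)
    (X : 'I_n -> Omega -> dbar.-tuple R) (w : Omega) (q : query R dbar) :
  (forall k, measurable_fun [set: Omega] (X k)) -> Qspace q ->
  `|deviation m i P X w q| <= n%:R.
Proof.
move=> mX Qq; rewrite /deviation ler_norml.
have /andP[f0 f1] := fD_bound m i (fun k => X k w) Qq.
have I0 : 0 <= Rintegral P setT (fun w => fD m i (fun k => X k w) q).
  by apply: Rintegral_ge0 => v _; have /andP[] := fD_bound m i (fun k => X k v) Qq.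
have I1 : Rintegral P setT (fun w => fD m i (fun k => X k w) q) <= n%:R.
  apply: (@le_trans _ _ (Rintegral P setT (fun=> n%:R))).
    apply: le_Rintegral => //; first exact: fD_integrable.
      by apply: (@bounded_integrable _ _ _ _ n%:R) => // v; rewrite normr_nat.
    by move=> v _; have /andP[] := fD_bound m i (fun k => X k v) Qq.
  by rewrite Rintegral_probability_cst.
by apply/andP; split; lra.
Qed.

Lemma sup_eventE (R : realType) (dbar n : nat) (m : 'I_dbar) (i : aggr)
    (d : measure_display) (Omega : measurableType d) (P : probability Omega R)
    (X : 'I_n -> Omega -> dbar.-tuple R) (e : R) : (0 < n)%N ->
  [set w | (n%:R^-1%:E * supnorm (deviation m i P X w) > e%:E)%E] =
  [set w | exists2 q, Qspace q & n%:R * e < `|deviation m i P X w q|].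
Proof.
move=> n0; have n0' : 0 < n%:R :> R by rewrite ltr0n.
apply/seteqP; split => w /=; rewrite lte_pdivlMl// -EFinM.
  by move=> /ereal_sup_gt[_ [q Qq <-]]; rewrite lte_fin => Hq; exists q.
move=> [q Qq Hq]; apply: (@lt_le_trans _ _ (`|deviation m i P X w q|)%:E).
  by rewrite lte_fin.
by apply: ereal_sup_ubound; exists q.
Qed.

Lemma COUNT_deviation_tail (R : realType) (dbar n : nat) (m : 'I_dbar)
    (chi : probability (dbar.-tuple R) R)
    (d : measure_display) (Omega : measurableType d) (P : probability Omega R)
    (X : 'I_n -> Omega -> dbar.-tuple R) (e : R) :
  (forall k, measurable_fun [set: Omega] (X k)) ->
  (forall k, has_law P (X k) chi) -> mutually_independent P X ->
  0 < e <= 1 ->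
  (P [set w | exists2 q, Qspace q & (n%:R * e < `|deviation m COUNT P X w q|)%R]
  <= (2 * (32 / e ^+ 2) ^+ (2 * dbar) * expR (- (e ^+ 2 * n%:R / 16)))%:E)%E.
Proof.
move=> mX lawX indX /andP[e0 e1]; apply: deviation_event_le => // N.
have e2 : 0 < e ^+ 2 <= 1 by rewrite exprn_gt0// exprn_ile1// ltW.
have l0 : 0 <= e / 4 by lra.
have u01 : 0 < e ^+ 2 / 32 <= 1 by lra.
(* With [l = e / 4] and [u = e ^+ 2 / 32], the coefficients of [e ^+ 2 * n] in the exponent are -1/4
   from Chernoff, 1/8 from [cosh_le] and 1/16 from the trace count, in total -1/16. *)
apply: le_trans (@fD_COUNT_finite_deviation _ _ _ m chi _ _ _ _
  {ffun 'I_dbar -> 'I_N.+2 * 'I_N.+2} (@grid_query R dbar N)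
  (e / 4) (n%:R * e) (e ^+ 2 / 32) mX lawX indX l0 u01) _.
rewrite lee_fin.
have HC : ((expR (e / 4) + expR (- (e / 4))) / 2) ^+ n <= expR (e ^+ 2 / 8 * n%:R).
  rewrite [_ * n%:R]mulrC expRM_natl; apply: lerXn2r.
  - by rewrite nnegrE divr_ge0// addr_ge0// expR_ge0.
  - by rewrite nnegrE expR_ge0.
  have -> : e ^+ 2 / 8 = 2 * (e / 4) ^+ 2 by field.
  by apply: cosh_le; apply/andP; split; lra.
have HU : (1 + e ^+ 2 / 32) ^+ (n * 2) <= expR (e ^+ 2 / 16 * n%:R).
  have -> : e ^+ 2 / 16 * n%:R = (n * 2)%:R * (e ^+ 2 / 32) by rewrite natrM; field.
  rewrite expRM_natl; apply: lerXn2r; rewrite ?nnegrE ?expR_ge0//; last exact: expR_ge1Dx.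
  by lra.
have -> : expR (- (e ^+ 2 * n%:R / 16)) = expR (- (e / 4 * (n%:R * e))) *
    (expR (e ^+ 2 / 16 * n%:R) * expR (e ^+ 2 / 8 * n%:R)).
  by rewrite -!expRD; congr expR; field.
have -> : (e ^+ 2 / 32) ^- (2 * dbar) = (32 / e ^+ 2) ^+ (2 * dbar).
  by rewrite -exprVn invf_div.
set A := _ ^+ (2 * dbar); set B := expR (- _).
have -> : 2 * A * (B * (expR (e ^+ 2 / 16 * n%:R) * expR (e ^+ 2 / 8 * n%:R))) =
  B * (2 * (A * expR (e ^+ 2 / 16 * n%:R) * expR (e ^+ 2 / 8 * n%:R))) by ring.
have A0 : 0 <= A by rewrite exprn_ge0// divr_ge0// ltW//; case/andP: e2.
apply: ler_wpM2l; first exact: expR_ge0.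
apply: ler_wpM2l => //.
apply: ler_pM => //.
- by apply: mulr_ge0 => //; apply: exprn_ge0; lra.
by apply: ler_wpM2l.
Qed.
Theorem theorem3p5 (R : realType) :
  exists kappa : R, 0 < kappa /\
  forall (dbar : nat), (1 <= dbar)%N ->
  forall (m : 'I_dbar) (chi : probability (dbar.-tuple R) R),
  chi [set p | forall j : 'I_dbar, 0 <= tnth p j <= 1] = 1%E ->
  forall (n : nat), (0 < n)%N ->
  forall (d : measure_display) (Omega : measurableType d) (P : probability Omega R)
    (X : 'I_n -> Omega -> dbar.-tuple R),
  (forall k, measurable_fun [set: Omega] (X k)) ->
  (forall k, has_law P (X k) chi) ->
  mutually_independent P X ->
  forall (eps2 : R), 0 < eps2 ->
  forall (i : aggr),
  let fDw := fun w : Omega => fD m i (fun k => X k w) in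
  let fchi := fun q : query R dbar => Rintegral P [set: Omega] (fun w => fDw w q) in
  (P [set w | ((n%:R)^-1)%:E * supnorm (fun q => (fchi q - fDw w q)%R) > eps2%:E]
  <= (kappa ^+ (2 * dbar).+1 * (2 * dbar)%:R * eps2 ^- (2 * dbar)
      * expR (- kappa^-1 * eps2 ^+ 2 * n%:R)%R)%:E)%E.
Proof.
(* The constant 32 is the base in [32 / e ^+ 2] of the COUNT tail and also the inverse rate, since
   the square root halves the rate 1/16. *)
exists 32; split => // dbar dbar_gt0 m chi _ n n_gt0 d Omega P X mX lawX indX e e0 i.
cbv zeta.
set b := 32 ^+ _ * _ * _ * _.
have b0 : 0 <= b.
  by rewrite !mulr_ge0 ?expR_ge0 ?exprn_ge0 ?invr_ge0 ?exprn_ge0// ltW.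
rewrite [X in P X](_ : _ = [set w | exists2 q, Qspace q &
    n%:R * e < `|deviation m i P X w q|]); last exact: sup_eventE.
(* For [1 < e] the event is empty, as deviations never exceed [n]; the COUNT tail covers
   [e <= 1]. *)
have [e1|e1] := ltP 1 e.
  rewrite (_ : [set w | _] = set0) ?measure0 ?lee_fin//.
  apply/seteqP; split => // w /= [q Qq]; apply/negP; rewrite -leNgt.
  apply: le_trans (deviation_bound m i P w mX Qq) _.
  by rewrite ler_peMr// ltW.
have -> : b = 32 ^+ (2 * dbar).+1 * (2 * dbar)%:R * e ^- (2 * dbar) *
  expR (- (e ^+ 2 * n%:R / 32)).
  by rewrite /b; congr (_ * expR _); field.
apply: (@le_trans _ _ (P [set w | exists2 q, Qspace q &
    (n%:R * e < `|deviation m COUNT P X w q|)%R])).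
  case: i => //.
  apply: le_measure; rewrite ?inE; try exact: measurable_deviation_event.
  move=> w /= [q Qq Hq]; apply: contrapT => Hn; move: Hq; apply/negP; rewrite -leNgt.
  apply: deviation_SUM_le => // q' Qq'; rewrite leNgt; apply/negP => Hq'.
  by apply: Hn; exists q'.
have e01 : 0 < e <= 1 by rewrite e0.
have := COUNT_deviation_tail m mX lawX indX e01.
set E := [set w | _].
have mE : measurable E by exact: measurable_deviation_event.
have PE1 : fine (P E) <= 1.
  by rewrite -lee_fin fineK ?fin_num_measure// probability_le1.
rewrite -[P E]fineK ?fin_num_measure// !lee_fin => HP.
(* [p <= 1] gives [p ^ 2 <= p], hence it suffices to bound [p] by the square of the target. *)
rewrite -ler_sqr ?nnegrE ?fine_ge0//; last first.
  by rewrite !mulr_ge0 ?expR_ge0 ?exprn_ge0 ?invr_ge0 ?exprn_ge0// ltW.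
apply: (@le_trans _ _ (fine (P E))); first by rewrite expr2 ler_piMl// fine_ge0.
apply: (le_trans HP).
(* The squared target is the COUNT tail with its factor 2 replaced by [32 ^+ (2 * dbar) * (32 * (2 *
   dbar)%:R) ^+ 2], which is larger. *)
have -> : (32 ^+ (2 * dbar).+1 * (2 * dbar)%:R * e ^- (2 * dbar) *
    expR (- (e ^+ 2 * n%:R / 32))) ^+ 2 =
  (32 ^+ (2 * dbar) * (32 * (2 * dbar)%:R) ^+ 2) *
    (32 / e ^+ 2) ^+ (2 * dbar) * expR (- (e ^+ 2 * n%:R / 16)).
  have -> : expR (- (e ^+ 2 * n%:R / 16)) = expR (- (e ^+ 2 * n%:R / 32)) ^+ 2.
    by rewrite -expRM_natl; congr expR; field.
  rewrite expr_div_n [e ^+ 2 ^+ _]exprAC [32 ^+ _.+1]exprS.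
  have : e ^+ (2 * dbar) != 0 by rewrite expf_neq0// gt_eqF.
  by move: (e ^+ _) (32 ^+ _) (expR _) => B A E' B0; field.
apply: ler_wpM2r; first exact: expR_ge0.
apply: ler_wpM2r; first by rewrite exprn_ge0// divr_ge0// ltW// exprn_gt0.
have h1 : 1 <= 32 ^+ (2 * dbar) :> R by rewrite exprn_ege1// ler1n.
have h2 : 2 <= (32 * (2 * dbar)%:R) ^+ 2 :> R.
  rewrite -natrM -natrX ler_nat; lia.
by rewrite -[2]mul1r; apply: ler_pM.
Qed.
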